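(* Let $n,k$ be positive integers with $k\le n$, let $\sigma>0$, let $\mu_1,\ldots,\mu_n\in[0,1]$ be arbitrary, and let $\mathcal{X}=\{x_1,\ldots,x_n\}\subseteq\mathbb{R}$, where $x_i=\mu_i+g_i$ with $g_1,\ldots,g_n$ independent one-dimensional Gaussian random variables with mean $0$ and standard deviation $\sigma$. Then (a) there is a polynomial $p$ (independent of $n,k,\sigma$ and the $\mu_i$) such that for every choice of initial centers the expected number of iterations of the $k$-means method on $\mathcal{X}$ is at most $p(n,1/\sigma)$; and (b) there are a polynomial $q$ and a constant $c>0$ (independent of $n,k,\sigma$ and the $\mu_i$) such that the probability that the number of iterations exceeds $q(n,1/\sigma)$ is at most $n^{-c}$.
   Context: The $k$-means method on a finite point set $\mathcal{X}\subseteq\mathbb{R}^d$ (here $d=1$) with $k$ clusters: (1) select initial cluster centers $c_1,\ldots,c_k$; (2) assign every $x\in\mathcal{X}$ to the cluster $C_i$ whose center $c_i$ is closest to $x$; (3) set $c_i=\frac{1}{|C_i|}\sum_{x\in C_i}x$ for every $i$; (4) if the clusters or the centers have changed, go to (2), otherwise terminate. An iteration is one execution of steps (2)–(3); the running time is the number of iterations. *)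

(* Defs.v *)
From HB Require Import structures.
From mathcomp Require Import all_boot all_order all_algebra.
From mathcomp Require Import all_classical all_reals all_analysis.
From mathcomp Require Import measurable_realfun normal_distribution.
Set Implicit Arguments. Unset Strict Implicit. Unset Printing Implicit Defensive.
Import Order.TTheory GRing.Theory Num.Theory.
Local Open Scope classical_set_scope.
Local Open Scope ring_scope.

Section KMeans.
Variables (R : realType) (n k : nat).
Implicit Types (x : 'I_n -> R) (c : 'I_k.+1 -> R) (a : 'I_n -> 'I_k.+1).

(* step (2): each point goes to a closest center (ties broken by the
   library's deterministic arg-min choice) *)
Definition kmeans_assign x c : {ffun 'I_n -> 'I_k.+1} :=
  [ffun i => [arg min_(j < ord0) `|x i - c j| ]%O].

Definition kmeans_update x a c : {ffun 'I_k.+1 -> R} :=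
  [ffun j => let m := #|[set i | a i == j]| in
             if m == 0%N then c j else (\sum_(i | a i == j) x i) / m%:R].

Fixpoint kmeans_state x c (t : nat)
  : option {ffun 'I_n -> 'I_k.+1} * {ffun 'I_k.+1 -> R} :=
  match t with
  | 0 => (None, [ffun j => c j])
  | t'.+1 => let cc := (kmeans_state x c t').2 in
             let a := kmeans_assign x cc in
             (Some a, kmeans_update x a cc)
  end.

(* number of iterations: least t >= 1 such that neither clusters nor centers
   changed in iteration t; +oo if the method never terminates *)
Definition kmeans_iterations x c : \bar R :=
  ereal_inf [set (t%:R)%:E | t in
    [set t : nat | (0 < t)%N /\ kmeans_state x c t = kmeans_state x c t.-1]].
End KMeans.

Definition bipoly {R : pzRingType} (D : nat) (a : nat -> nat -> R) (u v : R) : R :=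
  \sum_(i < D.+1) \sum_(j < D.+1) a i j * u ^+ i * v ^+ j.

Definition indep_gaussians {R : realType} {d} {T : measurableType d}
  (P : probability T R) (n : nat) (sigma : R) (g : 'I_n -> T -> R) : Prop :=
  [/\ forall i, measurable_fun [set: T] (g i),
      forall i (A : set R), measurable A ->
        P (g i @^-1` A) = normal_prob 0 sigma A &
      forall B : 'I_n -> set R, (forall i, measurable (B i)) ->
        P (\bigcap_(i in [set: 'I_n]) (g i @^-1` B i)) =
        (\big[*%E/1%E]_(i < n) P (g i @^-1` B i))%E].

(* Main.v *)
(* Compare the clusterings of two consecutive iterations and let [p] be the
   leftmost point whose cluster, as a set, changes.  Clusters are intervals, so
   the old cluster [O] and the new cluster [N] of [p] both start at [p] and one
   is a proper initial segment of the other.  If [O] is contained in [N], all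
   points of [O] move to a center that must be the mean of [O]; in both cases the
   potential (the sum of squared distances to the centers) drops by at least
   [(mean O - mean N)^2].  As a proper initial segment is strictly left of the
   rest, this gap is at least [delta / n^2], unless the smaller cluster is a
   single point and the larger one consists of two points at distance at most
   [delta].  If at most one pair of points is that close, the same argument from
   the right shows that a cheap step splits this pair, so that no two
   consecutive steps are cheap.

   Hence [m] large drops of size [(delta / n^2)^2] fit into the initial
   potential, at most [n M^2] when all points lie in [[-M, M]].  Two distinct
   pairs are [delta]-close only with probability [O(n^4 (delta / sigma)^2)]; the
   square is what makes the tail of the number of iterations decay like [1 / m].
   Summed over dyadic [m] up to the worst-case bound [2^(n^2)] on the number of
   clusterings, this tail gives a polynomial expectation, and Markov's inequality
   gives the second claim. *)

Require Import Defs.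
From HB Require Import structures.
From mathcomp Require Import all_boot all_order all_algebra.
From mathcomp Require Import all_classical all_reals all_analysis.
From mathcomp Require Import measurable_realfun normal_distribution.
From mathcomp Require Import ring lra zify.
Import Order.TTheory GRing.Theory Num.Theory.
Local Open Scope ring_scope.
Set Implicit Arguments. Unset Strict Implicit. Unset Printing Implicit Defensive.

(** * One step of the method *)

(** [pick] returns the head of an enumeration that lists ordinals in increasing order; hence the
    arg-min of [kmeans_assign] breaks ties towards the smaller index. *)
Lemma pick_ord_leq (m : nat) (P : pred 'I_m) (i j : 'I_m) :
  pick P = Some i -> P j -> (i <= j)%N.
Proof.
move=> Pi Pj.
have : sorted ltn (map val (enum P)).
  rewrite /enum_mem -enumT.
  apply: (subseq_sorted ltn_trans (s2 := map val (enum 'I_m))).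
    by apply: map_subseq; exact: filter_subseq.
  by rewrite val_enum_ord iota_ltn_sorted.
have : j \in enum P by rewrite mem_enum.
move: Pi; rewrite /pick; case: (enum _) => // l s [->].
rewrite inE => /orP[/eqP ->//|js] /= /(order_path_min ltn_trans)/allP/(_ (val j)).
by rewrite map_f// => /(_ isT)/ltnW.
Qed.

Section Clusterings.
Variables (R : realType) (n k : nat).
Implicit Types (x : 'I_n -> R) (c z : 'I_k.+1 -> R) (a : {ffun 'I_n -> 'I_k.+1}).
Implicit Types (A B S L : {set 'I_n}).

(** Lexicographic comparison of distance, then index. Its minimizer is unique, so the arg-min
    becomes an explicit condition, from which convexity and measurability of the clusters are
    derived. *)
Definition nearest (u : R) c (j : 'I_k.+1) : bool :=
  [forall m, (`|u - c j| < `|u - c m|) ||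
             ((`|u - c j| <= `|u - c m|) && (j <= m)%N)].

Lemma nearest_inj u c i j : nearest u c i -> nearest u c j -> i = j.
Proof.
move=> /forallP/(_ j)/orP[lij|/andP[lij ij]] /forallP/(_ i)/orP[lji|/andP[lji ji]].
- by have := lt_trans lij lji; rewrite ltxx.
- by have := lt_le_trans lij lji; rewrite ltxx.
- by have := le_lt_trans lij lji; rewrite ltxx.
- by apply/val_inj/anti_leq/andP.
Qed.

Lemma nearest_assign x c i : nearest (x i) c (kmeans_assign x c i).
Proof.
pose F j : R := `|x i - c j|.
have [j0 min0] : exists j0, forall j, F j0 <= F j.
  by have [j0 _ min0] := @arg_minP _ R _ ord0 xpredT F isT; exists j0 => j; exact: min0.
rewrite ffunE.
rewrite /Order.arg_min /extremum.
set q := (X in odflt _ X); case Ej : q => [j|] /=; last first.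
  move: Ej; rewrite /q; case: pickP => // /(_ j0) /= /forallP; case=> m.
  by rewrite -/F; apply/implyP => _; exact: min0.
have minj m : F j <= F m.
  by move: Ej; rewrite /q; case: pickP => // l /= /forallP/(_ m)/implyP/(_ isT) + [<-].
apply/forallP => m /=; have [//|Fmj /=] := ltP (F j) (F m).
rewrite -/(F j) -/(F m) minj /=; apply: (@pick_ord_leq _ _ _ m Ej) => /=.
by apply/forallP => l; apply/implyP => _; exact: le_trans Fmj (minj l).
Qed.

Lemma assignE x c i j : (kmeans_assign x c i == j) = nearest (x i) c j.
Proof.
apply/eqP/idP => [<-|]; first exact: nearest_assign.
exact: nearest_inj (nearest_assign x c i).
Qed.

Lemma assign_le x c i m : `|x i - c (kmeans_assign x c i)| <= `|x i - c m|.
Proof.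
by have /forallP/(_ m)/orP[/ltW|/andP[]] := nearest_assign x c i.
Qed.

Definition convex_clusters x a := forall p q r,
  x p <= x q -> x q <= x r -> a p = a r -> a q = a p.

(** After squaring, preferring center [j] to center [m] is an affine inequality in the position of
    the point, weak or strict according to the tie rule. If it holds at [x p] and at [x r], it holds
    in between. *)
Lemma convex_assign x c : convex_clusters x (kmeans_assign x c).
Proof.
move=> p q r pq qr apr; apply/eqP; rewrite assignE; apply/forallP => m.
set j := kmeans_assign x c p.
have /forallP/(_ m)/= hp : nearest (x p) c j by exact: nearest_assign.
have /forallP/(_ m)/= hr : nearest (x r) c j.
  by rewrite /j apr; exact: nearest_assign.
have sq (u v : R) : (`|u| <= `|v|) = (u ^+ 2 <= v ^+ 2).
  by rewrite -(real_normK (num_real u)) -(real_normK (num_real v)) ler_sqr ?nnegrE.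
have sqlt (u v : R) : (`|u| < `|v|) = (u ^+ 2 < v ^+ 2) by rewrite !ltNge sq.
have [jm|jm] := leqP j m.
  move: hp hr; rewrite !jm !andbT !sq !sqlt.
  have E (b b' : R) : (b < b') || (b <= b') = (b <= b').
    by rewrite orb_idl// => /ltW.
  rewrite !E => hp hr.
  have h (u : R) : ((u - c j) ^+ 2 <= (u - c m) ^+ 2) =
             (0 <= (c j - c m) * (2 * u - c j - c m)).
    by rewrite -subr_ge0; congr (_ <= _); ring.
  move: hp hr; rewrite !h => hp hr.
  have [cm|cm] := leP (c m) (c j).
    by apply: le_trans hp _; rewrite ler_wpM2l ?subr_ge0//; lra.
  by apply: le_trans hr _; rewrite ler_wnM2l ?subr_le0 ?(ltW cm)//; lra.
move: hp hr; rewrite leqNgt jm !andbF !orbF !sqlt => hp hr.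
have h (u : R) : ((u - c j) ^+ 2 < (u - c m) ^+ 2) =
           (0 < (c j - c m) * (2 * u - c j - c m)).
  by rewrite -subr_gt0; congr (_ < _); ring.
move: hp hr; rewrite !h => hp hr.
have [cm|cm] := leP (c m) (c j).
  by apply: lt_le_trans hp _; rewrite ler_wpM2l ?subr_ge0//; lra.
by apply: lt_le_trans hr _; rewrite ler_wnM2l ?subr_le0 ?(ltW cm)//; lra.
Qed.

(** * Cluster means and the cost of a clustering *)

Definition mean x S : R := (\sum_(i in S) x i) / #|S|%:R.

(** Clusters are compared as sets around a point, so that a mere relabelling does not count as a
    change. *)
Definition cell a p : {set 'I_n} := [set q | a q == a p].

Definition cost x a c : R := \sum_i (x i - c (a i)) ^+ 2.

(** Quantifying over points leaves the centers of empty clusters free; [kmeans_update] keeps those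
    where they were. *)
Definition centered x a c := forall p, c (a p) = mean x (cell a p).

Lemma mem_cell a p : p \in cell a p. Proof. by rewrite inE. Qed.

Lemma cell_eq a p q : q \in cell a p -> cell a q = cell a p.
Proof. by rewrite inE => /eqP qp; apply/setP => r; rewrite !inE qp. Qed.

Lemma sum_meanE x S : \sum_(i in S) x i = #|S|%:R * mean x S.
Proof.
have [->|/set0Pn[i iS]] := eqVneq S finset.set0; first by rewrite big_set0 cards0 mul0r.
rewrite /mean mulrC divfK// pnatr_eq0 -lt0n; apply/card_gt0P; by exists i.
Qed.

(** The parallel axis identity: deviations from the mean sum to zero, so no cross term remains. *)
Lemma sum_sqr_mean x S u : \sum_(i in S) (x i - u) ^+ 2 =
  \sum_(i in S) (x i - mean x S) ^+ 2 + #|S|%:R * (u - mean x S) ^+ 2.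
Proof.
set m := mean x S.
have -> : \sum_(i in S) (x i - u) ^+ 2 =
    \sum_(i in S) ((x i - m) ^+ 2 + ((m - u) * 2 * x i + (u ^+ 2 - m ^+ 2))).
  by apply: eq_bigr => i _; ring.
rewrite big_split /= big_split /= -mulr_sumr sumr_const (sum_meanE x S) -/m.
rewrite -[_ *+ #|S|]mulr_natr.
ring.
Qed.

Lemma mean_minimal x S u :
  \sum_(i in S) (x i - mean x S) ^+ 2 <= \sum_(i in S) (x i - u) ^+ 2.
Proof. by rewrite (sum_sqr_mean x S u) lerDl mulr_ge0// sqr_ge0. Qed.

(** [P] selects whole clusters, so the sum splits by cluster and the mean is optimal in each.
    [cost_drop] applies this to all clusters but one. *)
Lemma cost_centered_le (P : pred 'I_k.+1) x a c z : centered x a c ->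
  \sum_(i | P (a i)) (x i - c (a i)) ^+ 2 <=
  \sum_(i | P (a i)) (x i - z (a i)) ^+ 2.
Proof.
move=> ctr; rewrite (partition_big a P)//= [leRHS](partition_big a P)//=.
apply: ler_sum => j Pj.
have E (F : 'I_k.+1 -> R) : \sum_(i | P (a i) && (a i == j)) (x i - F (a i)) ^+ 2
    = \sum_(i in [set i | a i == j]) (x i - F j) ^+ 2.
  rewrite (eq_bigl (fun i => i \in [set i | a i == j])); last first.
    by move=> i; rewrite inE andb_idl// => /eqP ->.
  by apply: eq_bigr => i; rewrite inE => /eqP ->.
rewrite !E.
have [->|/set0Pn[p]] := eqVneq [set i | a i == j] finset.set0; first by rewrite !big_set0.
rewrite inE => /eqP <-; rewrite ctr -/(cell a p); exact: mean_minimal.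
Qed.

(** Multiplied by [#|L| * #|S|], the gap of the means is the sum of [x v - x u] over all [u] in [S]
    and [v] in [L :\: S]. All terms are positive, so each is at most the sum, and both cardinals are
    at most [n]. *)
Lemma mean_gap x S L s y : S \proper L ->
  (forall u v, u \in S -> v \in L :\: S -> x u < x v) ->
  s \in S -> y \in L :\: S -> x y - x s <= n%:R ^+ 2 * (mean x L - mean x S).
Proof.
move=> SL lt_SL sS yLS.
have cS : (0 < #|S|)%N by apply/card_gt0P; exists s.
have E : #|L|%:R * #|S|%:R * (mean x L - mean x S) =
    \sum_(v in L :\: S) \sum_(u in S) (x v - x u).
  transitivity (\sum_(v in L :\: S) (#|S|%:R * x v - \sum_(u in S) x u)).
    have := sum_meanE x L; rewrite (big_setID S) /= (finset.setIidPr (proper_sub SL)).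
    rewrite big_split /= -mulr_sumr sumr_const (sum_meanE x S) => h.
    have cL : #|L|%:R = #|S|%:R + #|L :\: S|%:R :> R.
      by rewrite -natrD -(cardsID S L) (finset.setIidPr (proper_sub SL)).
    rewrite -[_ *+ #|_|]mulr_natr cL in h *.
    have -> : \sum_(i in L :\: S) x i =
        (#|S|%:R + #|L :\: S|%:R) * mean x L - #|S|%:R * mean x S.
      by rewrite -h; ring.
    ring.
  apply: eq_bigr => v _; rewrite big_split /= sumr_const sumrN.
  by rewrite -[x v *+ _]mulr_natl.
have pos v u : v \in L :\: S -> u \in S -> 0 <= x v - x u.
  by move=> vL uS; rewrite subr_ge0 ltW// lt_SL.
have h1 : x y - x s <= #|L|%:R * #|S|%:R * (mean x L - mean x S).
  rewrite E (bigD1 y)//= (bigD1 s)//= -addrA lerDl addr_ge0//.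
    by apply: sumr_ge0 => u /andP[uS _]; exact: pos.
  apply: sumr_ge0 => v /andP[vL _]; apply: sumr_ge0 => u uS; exact: pos.
apply: (le_trans h1).
have h0 : 0 <= mean x L - mean x S.
  have : 0 <= #|L|%:R * #|S|%:R * (mean x L - mean x S).
    by apply: le_trans h1; exact: pos.
  rewrite pmulr_rge0// -natrM ltr0n muln_gt0 cS andbT.
  by apply: leq_trans cS _; exact: subset_leq_card (proper_sub SL).
rewrite ler_wpM2r// expr2 ler_pM// ler_nat.
  by rewrite -[leqRHS]card_ord max_card.
by rewrite -[leqRHS]card_ord max_card.
Qed.

Lemma mean_oppr x S : mean (fun i => - x i) S = - mean x S.
Proof. by rewrite /mean sumrN mulNr. Qed.

Definition lower_part x S L := S \proper L /\
  forall u v, u \in S -> v \in L :\: S -> x u < x v.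

Section Step.
Variables (x : 'I_n -> R) (a a' : {ffun 'I_n -> 'I_k.+1}) (c c' : 'I_k.+1 -> R).
Hypothesis ctr : centered x a c.
Hypothesis ctr' : centered x a' c'.
Hypothesis near' : forall i m, `|x i - c (a' i)| <= `|x i - c m|.

Lemma near_sqr i m : (x i - c (a' i)) ^+ 2 <= (x i - c m) ^+ 2.
Proof.
by rewrite -(real_normK (num_real (_ - c m))) -(real_normK (num_real (_ - c _)))
  ler_sqr ?nnegrE// near'.
Qed.

(* All points of the old cell prefer the center [c (a' p)] to their own, which
   is their mean and hence the unique minimizer of the cost of the cell. *)
Lemma subcell_center p : cell a p \subset cell a' p -> c (a' p) = mean x (cell a p).
Proof.
move=> sub; set S := cell a p.
have : \sum_(i in S) (x i - c (a' p)) ^+ 2 <= \sum_(i in S) (x i - mean x S) ^+ 2.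
  apply: ler_sum => i iS; rewrite -ctr.
  have := fintype.subsetP sub _ iS; rewrite inE => /eqP <-.
  exact: near_sqr.
rewrite (sum_sqr_mean _ _ (c (a' p))) gerDl => h.
have cS : 0 < #|S|%:R :> R by rewrite ltr0n; apply/card_gt0P; exists p; exact: mem_cell.
move: h; rewrite pmulr_rle0// => h.
by apply/eqP; rewrite -subr_eq0 -sqrf_eq0 eq_le h sqr_ge0.
Qed.

(** Before the step, the points of [N] cost at least their squared distances to the mean of [O]:
    this mean is the old center nearest to them if [O] is contained in [N], and their own old center
    otherwise. Moving it to the mean of [N] saves [#|N|] times the squared gap, and the other
    clusters get no more expensive. *)
Lemma cost_drop p :
  cell a p \subset cell a' p \/ cell a' p \subset cell a p ->
  (mean x (cell a p) - mean x (cell a' p)) ^+ 2 <= cost x a c - cost x a' c'.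
Proof.
set O := cell a p; set N := cell a' p => ON.
have hN : \sum_(i in N) (x i - mean x O) ^+ 2 <= \sum_(i in N) (x i - c (a i)) ^+ 2.
  apply: ler_sum => i iN; case: ON => [sON|sNO].
    rewrite -(subcell_center sON); move: iN; rewrite inE => /eqP <-.
    exact: near_sqr.
  by have := fintype.subsetP sNO _ iN; rewrite inE => /eqP ->; rewrite ctr.
have hC : \sum_(i | a' i != a' p) (x i - c' (a' i)) ^+ 2 <=
          \sum_(i | a' i != a' p) (x i - c (a i)) ^+ 2.
  apply: (le_trans (cost_centered_le (fun j => j != a' p) c ctr')).
  by apply: ler_sum => i _; exact: near_sqr.
rewrite /cost (bigID (fun i => a' i == a' p)) /=.
rewrite [X in _ <= _ - X](bigID (fun i => a' i == a' p)) /=.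
have EN F : \sum_(i | a' i == a' p) F i = \sum_(i in N) F i :> R.
  by apply: eq_bigl => i; rewrite inE.
rewrite !EN.
have -> : \sum_(i in N) (x i - c' (a' i)) ^+ 2 = \sum_(i in N) (x i - mean x N) ^+ 2.
  by apply: eq_bigr => i; rewrite inE => /eqP ->; rewrite ctr'.
have cN : 1 <= #|N|%:R :> R.
  by rewrite ler1n; apply/card_gt0P; exists p; exact: mem_cell.
move: hN; rewrite (sum_sqr_mean _ _ (mean x O)) => hN.
have : (mean x O - mean x N) ^+ 2 <= #|N|%:R * (mean x O - mean x N) ^+ 2.
  by rewrite ler_peMl// sqr_ge0.
lra.
Qed.
End Step.

(** Let [p] be the leftmost point whose cell changes. A point further left in either cell of [p]
    would have an unchanged cell containing [p], a contradiction. So both cells start at [p], and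
    convex cells with a common left end are nested. *)
Lemma leftmost_change x a a' : convex_clusters x a -> convex_clusters x a' ->
  (exists p, cell a p != cell a' p) ->
  exists p, lower_part x (cell a p) (cell a' p) \/ lower_part x (cell a' p) (cell a p).
Proof.
move=> cvx cvx' [p0 p0P].
have [p pP pmin] := @arg_minP _ R _ p0 (fun p => cell a p != cell a' p) x p0P.
exists p.
have lowO q : q \in cell a p -> x p <= x q.
  move=> qO; rewrite leNgt; apply/negP => qp.
  have /eqP eqq : cell a q == cell a' q.
    by apply: contraLR qp => h; rewrite -leNgt; exact: pmin.
  have pq' : p \in cell a' q by rewrite -eqq (cell_eq qO) mem_cell.
  by move/eqP: pP; apply; rewrite -(cell_eq qO) eqq (cell_eq pq').
have lowN q : q \in cell a' p -> x p <= x q.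
  move=> qN; rewrite leNgt; apply/negP => qp.
  have /eqP eqq : cell a q == cell a' q.
    by apply: contraLR qp => h; rewrite -leNgt; exact: pmin.
  have pq' : p \in cell a q by rewrite eqq (cell_eq qN) mem_cell.
  by move/eqP: pP; apply; rewrite -(cell_eq qN) -eqq (cell_eq pq').
have part b b' : convex_clusters x b -> (forall q, q \in cell b' p -> x p <= x q) ->
    cell b p \subset cell b' p -> cell b p != cell b' p ->
    lower_part x (cell b p) (cell b' p).
  move=> cvxb low sub neq; split; first by rewrite finset.properEneq neq.
  move=> u v uS /finset.setDP[vL vS]; rewrite ltNge; apply/negP => vu.
  move/negP: vS; apply; rewrite inE; apply/eqP; apply: (cvxb p v u) => //.
    exact: low.
  by move: uS; rewrite inE => /eqP.
have [sub|/fintype.subsetPn[y yO yN]] := boolP (cell a p \subset cell a' p).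
  by left; exact: part.
right; apply: part => //; last by rewrite eq_sym.
apply/fintype.subsetP => z zN; rewrite inE; apply/eqP.
have zy : x z <= x y.
  rewrite leNgt; apply/negP => yz; move/negP: yN; apply; rewrite inE; apply/eqP.
  apply: (cvx' p y z); [exact: lowO|exact: ltW|by move: zN; rewrite inE => /eqP].
by apply: (cvx p z y) => //; [exact: lowN|move: yO; rewrite inE => /eqP].
Qed.
End Clusterings.

(** * Runs *)

Section Runs.
Variables (R : realType) (n k : nat).
Implicit Types (x : 'I_n -> R) (c : 'I_k.+1 -> R) (a : {ffun 'I_n -> 'I_k.+1}).

(** [r] and [r'] may coincide, but [u] and [u'] differ from each other and from both references. Any
    two distinct pairs can be named this way, and once the references are fixed, the two conditions
    concern independent variables. *)
Definition two_close_pairs x (delta : R) := exists u r u' r' : 'I_n,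
  [/\ u != u', u != r, u != r', u' != r & u' != r'] /\
  `|x u - x r| <= delta /\ `|x u' - x r'| <= delta.

(** Each of two distinct pairs has a point outside the other; these two points serve as [u] and
    [u']. *)
Lemma close_pair_uniq x delta s y s' y' : ~ two_close_pairs x delta ->
  s != y -> `|x s - x y| <= delta -> s' != y' -> `|x s' - x y'| <= delta ->
  s = s' /\ y = y' \/ s = y' /\ y = s'.
Proof.
move=> ntc sy dsy sy' dsy'.
have tc u r u' r' : u != u' -> u != r -> u != r' -> u' != r -> u' != r' ->
    `|x u - x r| <= delta -> `|x u' - x r'| <= delta -> False.
  by move=> *; apply: ntc; exists u, r, u', r'; do !split.
have dys : `|x y - x s| <= delta by rewrite distrC.
have dys' : `|x y' - x s'| <= delta by rewrite distrC.
have ys : y != s by rewrite eq_sym.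
have ys' : y' != s' by rewrite eq_sym.
have [ss|ss] := eqVneq s s'.
  left; split=> //; apply/eqP/negPn/negP => yy; subst s'.
  by apply: (tc y s y' s) => //.
have [sy0|sy0] := eqVneq s y'.
  right; split=> //; apply/eqP/negPn/negP => yy; subst y'.
  by apply: (tc y s s' s) => //.
exfalso; have [yy|yy] := eqVneq y s'.
  by subst s'; apply: (tc s y y' y) => //.
have [yy'|yy'] := eqVneq y y'.
  by subst y'; apply: (tc s y s' y) => //; rewrite eq_sym.
by apply: (tc s y s' y') => //; rewrite eq_sym.
Qed.

(** Reflecting the line, here and in the next lemmas, turns the leftmost change into the rightmost
    one. *)
Lemma cost_oppr x a c : cost (fun i => - x i) a (fun j => - c j) = cost x a c.
Proof. by apply: eq_bigr => i _; rewrite -opprD sqrrN. Qed.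

Lemma convex_oppr x a : convex_clusters x a -> convex_clusters (fun i => - x i) a.
Proof.
move=> cvx p q r; rewrite !lerN2 => qp rq apr.
by rewrite (cvx r q p).
Qed.

Lemma centered_oppr x a c : centered x a c ->
  centered (fun i => - x i) a (fun j => - c j).
Proof. by move=> ctr p; rewrite ctr mean_oppr. Qed.

Lemma two_close_oppr x delta : two_close_pairs (fun i => - x i) delta ->
  two_close_pairs x delta.
Proof.
move=> [u [r [u' [r' [neq [d d']]]]]]; exists u, r, u', r'; split=> //.
by move: d d'; rewrite -!opprD !normrN.
Qed.

Lemma mean1 x i : mean x [set i]%SET = x i.
Proof. by rewrite /mean big_set1 cards1 divr1. Qed.

(** The threshold is the square of the gap of means that [mean_gap] guarantees for points more than
    [delta] apart. *)
Definition cheap_step x (delta : R) a c a' c' :=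
  cost x a c - cost x a' c' < (delta / n%:R ^+ 2) ^+ 2.

Lemma lower_part_close x S L s y delta : 0 <= delta -> lower_part x S L ->
  s \in S -> y \in L :\: S ->
  (mean x L - mean x S) ^+ 2 < (delta / n%:R ^+ 2) ^+ 2 -> `|x s - x y| <= delta.
Proof.
move=> d0 [SL lt_SL] sS yL hsq.
have sy := lt_SL _ _ sS yL.
rewrite distrC gtr0_norm ?subr_gt0//.
apply: (le_trans (mean_gap SL lt_SL sS yL)).
have n0 : 0 < n%:R ^+ 2 :> R.
  by rewrite exprn_gt0// ltr0n; case: (n) s {S L SL lt_SL sS y yL hsq sy} x => [[]|].
rewrite mulrC -ler_pdivlMr//; apply: (le_trans (ler_norm _)).
have dn : 0 <= delta / n%:R ^+ 2 by rewrite divr_ge0// ltW.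
by rewrite -(ger0_norm dn) -ler_sqr ?nnegrE// !real_normK ?num_real// ltW.
Qed.

(** By [lower_part_close], the points of the smaller cell are close to the remaining points of the
    larger one. A shrinking cell loses such a point [y], which splits the pair. A growing cell is a
    singleton by uniqueness of the close pair, and [subcell_center] puts the center it joins at that
    single point. *)
Lemma cheap_step_left x delta a c a' c' : 0 <= delta -> ~ two_close_pairs x delta ->
  convex_clusters x a -> convex_clusters x a' ->
  centered x a c -> centered x a' c' ->
  (forall i m, `|x i - c (a' i)| <= `|x i - c m|) ->
  (exists p, cell a p != cell a' p) -> cheap_step x delta a c a' c' ->
  exists s y, [/\ x s < x y, `|x s - x y| <= delta &
    (a s = a y /\ a' s != a' y) \/ (a' s = a' y /\ c (a' s) = x s)].
Proof.
move=> d0 ntc cvx cvx' ctr ctr' near' chg cheap.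
have [p [low|low]] := leftmost_change cvx cvx' chg.
- have [/properP[sub [y yN yO]] lt_ON] := low.
  have yNO : y \in cell a' p :\: cell a p by rewrite finset.inE yO.
  have hsq : (mean x (cell a' p) - mean x (cell a p)) ^+ 2 < (delta / n%:R ^+ 2) ^+ 2.
    apply: le_lt_trans cheap; rewrite -[leLHS]sqrrN opprB.
    by apply: cost_drop => //; left.
  have close q : q \in cell a p -> `|x q - x y| <= delta.
    by move=> qO; exact: (lower_part_close d0 low qO yNO hsq).
  have ney q : q \in cell a p -> q != y.
    by move=> qO; apply: contraNneq yO => <-.
  have pO := mem_cell a p.
  exists p, y; split; [exact: lt_ON|exact: close|right].
  split; first by move: yN; rewrite finset.inE => /eqP.
  rewrite (subcell_center ctr near' sub).
  suff -> : cell a p = [set p]%SET by exact: mean1.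
  apply/setP => q; rewrite [RHS]finset.inE; apply/idP/eqP => [qO|->//].
  have := close_pair_uniq ntc (ney _ qO) (close _ qO) (ney _ pO) (close _ pO).
  by move=> [[]|[qy]]//; have := ney _ qO; rewrite qy eqxx.
- have [/properP[sub [y yO yN]] lt_NO] := low.
  have yON : y \in cell a p :\: cell a' p by rewrite finset.inE yN.
  have pN := mem_cell a' p.
  have hsq : (mean x (cell a p) - mean x (cell a' p)) ^+ 2 < (delta / n%:R ^+ 2) ^+ 2.
    by apply: le_lt_trans cheap; apply: cost_drop => //; right.
  exists p, y; split; [exact: lt_NO|exact: (lower_part_close d0 low pN yON hsq)|left].
  move: yO yN; rewrite !finset.inE => /eqP -> yN; split=> //.
  by rewrite eq_sym.
Qed.

(* Otherwise the leftmost and the rightmost changes both merge the unique close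
   pair [s], [y] into a cluster whose center is at once [x s] and [x y]. *)
Lemma cheap_step_split x delta a c a' c' : 0 <= delta -> ~ two_close_pairs x delta ->
  convex_clusters x a -> convex_clusters x a' ->
  centered x a c -> centered x a' c' ->
  (forall i m, `|x i - c (a' i)| <= `|x i - c m|) ->
  (exists p, cell a p != cell a' p) -> cheap_step x delta a c a' c' ->
  exists s y, [/\ s != y, `|x s - x y| <= delta, a s = a y & a' s != a' y].
Proof.
move=> d0 ntc cvx cvx' ctr ctr' near' chg cheap.
have ne_lt s y : x s < x y -> s != y by apply: contraTneq => ->; rewrite ltxx.
have [s [y [sy dsy]]] := cheap_step_left d0 ntc cvx cvx' ctr ctr' near' chg cheap.
move=> [[? ?]|[asy cs]]; first by exists s, y; split=> //; exact: ne_lt.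
have nearN i m : `|- x i - - c (a' i)| <= `|- x i - - c m|.
  by rewrite -!opprD !normrN.
have cheapN : cheap_step (fun i => - x i) delta a (fun j => - c j) a' (fun j => - c' j).
  by rewrite /cheap_step !cost_oppr.
have ntcN : ~ two_close_pairs (fun i => - x i) delta by move/two_close_oppr.
have [s' [y' [sy' dsy']]] := cheap_step_left d0 ntcN (convex_oppr cvx)
  (convex_oppr cvx') (centered_oppr ctr) (centered_oppr ctr') nearN chg cheapN.
move: sy' dsy'; rewrite ltrN2 -opprD normrN => sy' dsy'.
have neq' : s' != y' by rewrite eq_sym ne_lt.
move=> [[? ?]|[asy' /oppr_inj cs']]; first by exists s', y'.
have [[? ?]|[? ?]] := close_pair_uniq ntc (ne_lt _ _ sy) dsy neq' dsy'.
  by subst s' y'; have := lt_trans sy sy'; rewrite ltxx.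
by subst s' y'; move: sy; rewrite -cs -cs' asy ltxx.
Qed.

(** * The sequence of clusterings in a fixed run *)

Variables (x : 'I_n -> R) (c0 : 'I_k.+1 -> R).

(** [A t] is the clustering computed in iteration [t.+1], and [potential t] its cost once the
    centers have been updated. *)
Let C t : 'I_k.+1 -> R := (kmeans_state x c0 t).2.
Let A t := kmeans_assign x (C t).
Let potential t := cost x (A t) (C t.+1).

Lemma centered_update a c : centered x a (kmeans_update x a c).
Proof.
move=> p; rewrite /kmeans_update ffunE.
have -> : #|[set i | a i == a p]%classic| = #|cell a p|.
  by apply: eq_card => i; rewrite finset.inE; apply/idP/idP => [/set_mem//|?]; exact/mem_set.
have -> : (#|cell a p| == 0)%N = false.
  by apply/negbTE; rewrite -lt0n; apply/card_gt0P; exists p; exact: mem_cell.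
by rewrite /mean; congr (_ / _); apply: eq_bigl => i; rewrite finset.inE.
Qed.

Lemma update_empty a c j : (forall i, a i != j) -> kmeans_update x a c j = c j.
Proof.
move=> aj; rewrite ffunE.
suff -> : #|[set i | a i == j]%classic| = 0%N by rewrite /=.
by apply: eq_card0 => i; apply/negP => /set_mem /=; apply/negP.
Qed.

Lemma potential_ge0 t : 0 <= potential t.
Proof. by apply: sumr_ge0 => i _; exact: sqr_ge0. Qed.

(** The updated centers are optimal for the first clustering, hence no worse than centers all placed
    at 0. *)
Lemma potential0_le : potential 0 <= \sum_i x i ^+ 2.
Proof.
have := @cost_centered_le R n k xpredT x (A 0) (C 1) (fun=> 0) (centered_update _ _).
by move=> /le_trans; apply; apply: ler_sum => i _; rewrite subr0.
Qed.

Lemma potential_assign s t : A s = A t -> potential s = potential t.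
Proof.
move=> Ast; apply: eq_bigr => i _.
by rewrite /C /= !centered_update -/(A s) -/(A t) Ast.
Qed.

(** By [subcell_center], each point is assigned to a center equal to the mean of its unchanged cell,
    so the update moves no center. Labels may still change in iteration [t.+2] if centers coincide;
    hence one more iteration before the states agree. *)
Lemma same_cells_stop t : (forall p, cell (A t) p = cell (A t.+1) p) ->
  kmeans_state x c0 t.+3 = kmeans_state x c0 t.+2.
Proof.
move=> same.
have CC : (kmeans_state x c0 t.+2).2 = (kmeans_state x c0 t.+1).2.
  apply/ffunP => j; have [[p <-]|no] := pselect (exists p, A t.+1 p = j).
    have e2 : C t.+2 (A t.+1 p) = mean x (cell (A t.+1) p).
      exact: centered_update.
    have e1 : C t.+1 (A t.+1 p) = mean x (cell (A t) p).
      apply: subcell_center; rewrite ?same//; first exact: centered_update.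
      by move=> i m; exact: assign_le.
    by rewrite -/(C t.+2) -/(C t.+1) e1 e2 same.
  by rewrite update_empty// => i; apply/eqP => ij; apply: no; exists i.
have AA : A t.+2 = A t.+1 by rewrite /A /C CC.
have E u : kmeans_state x c0 u.+1 =
    (Some (A u), kmeans_update x (A u) (kmeans_state x c0 u).2).
  by [].
by rewrite E AA CC [RHS]E.
Qed.

Lemma iterations_le t : kmeans_state x c0 t.+1 = kmeans_state x c0 t ->
  (kmeans_iterations x c0 <= t.+1%:R%:E)%E.
Proof. by move=> st; apply: ereal_inf_lbound; exists t.+1. Qed.

Lemma cells_change N t : (N%:R%:E < kmeans_iterations x c0)%E -> (t.+3 <= N)%N ->
  exists p, cell (A t) p != cell (A t.+1) p.
Proof.
move=> NT tN; apply/existsP; apply: contraT; rewrite negb_exists => /forallP same.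
have /iterations_le : kmeans_state x c0 t.+3 = kmeans_state x c0 t.+2.
  by apply: same_cells_stop => p; apply/eqP; have := same p; rewrite negbK.
move=> /(lt_le_trans NT); rewrite lte_fin ltr_nat => /leq_trans/(_ tN).
by rewrite ltnn.
Qed.

(** The drop is at least the squared gap of two means, which is nonzero because [lower_part]
    separates points strictly. *)
Lemma potential_decr t : (exists p, cell (A t) p != cell (A t.+1) p) ->
  potential t.+1 < potential t.
Proof.
move=> chg; rewrite -subr_gt0.
have gap S L : lower_part x S L -> (exists s, s \in S) -> mean x L - mean x S != 0.
  move=> [SL lt_SL] [s sS]; have /properP[_ [y yL yS]] := SL.
  have yLS : y \in L :\: S by rewrite finset.inE yS.
  have := mean_gap SL lt_SL sS yLS; apply: contraTneq => ->.
  by rewrite mulr0 -ltNge subr_gt0 lt_SL.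
have [p pP] := leftmost_change (@convex_assign _ _ _ x _) (@convex_assign _ _ _ x _) chg.
have sub : cell (A t) p \subset cell (A t.+1) p \/ cell (A t.+1) p \subset cell (A t) p.
  by case: pP => -[/proper_sub ? _]; [left|right].
apply: (@lt_le_trans _ _ ((mean x (cell (A t) p) - mean x (cell (A t.+1) p)) ^+ 2)).
  rewrite lt_def sqr_ge0 sqrf_eq0 andbT; case: pP => /gap; last first.
    by apply; exists p; exact: mem_cell.
  by rewrite -oppr_eq0 opprB; apply; exists p; exact: mem_cell.
apply: cost_drop => //; [exact: centered_update|exact: centered_update|].
by move=> i m; exact: assign_le.
Qed.

(** The potential decreases strictly and depends only on the clustering, so [A 0] to [A N] are
    distinct among [k.+1 ^ n] assignments. *)
Lemma run_worst_case N : (N.+2%:R%:E < kmeans_iterations x c0)%E ->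
  (N < k.+1 ^ n)%N.
Proof.
move=> NT.
have decr t m : (t + m < N)%N -> potential (t + m).+1 < potential t.
  elim: m => [|m IH] tm.
    by rewrite addn0 in tm *; apply/potential_decr/(cells_change NT).
  apply: (@lt_trans _ _ (potential (t + m.+1))); last by rewrite addnS IH; lia.
  by apply/potential_decr/(cells_change NT).
have decr' s t : (s < t)%N -> (t <= N)%N -> A s <> A t.
  move=> st tN /potential_assign e.
  have := @decr s (t - s).-1; have -> : (s + (t - s).-1).+1 = t by lia.
  by rewrite e ltxx; lia.
have inj : injective (fun i : 'I_N.+1 => A i).
  move=> i j Aij; apply/val_inj; have [ij|ij|//] := ltngtP i j.
    by case: (decr' i j ij _ Aij); rewrite -ltnS.
  by case: (decr' j i ij _ (esym Aij)); rewrite -ltnS.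
by have := leq_card _ inj; rewrite card_ffun !card_ord.
Qed.

(** Of two consecutive steps one is not cheap: a cheap step leaves the close pair split, whereas
    another one right after it would have to start with the pair joined. So every two steps yield a
    large drop. The summand 2 in [2 * m + 2] covers the delay in [same_cells_stop]. *)
Lemma run_potential m delta : 0 < delta -> ~ two_close_pairs x delta ->
  ((2 * m + 2)%:R%:E < kmeans_iterations x c0)%E ->
  m%:R * (delta / n%:R ^+ 2) ^+ 2 <= \sum_i x i ^+ 2.
Proof.
move=> d0 ntc NT; apply: le_trans potential0_le.
have chg t : (t < 2 * m)%N -> exists p, cell (A t) p != cell (A t.+1) p.
  by move=> tm; apply: (cells_change NT); lia.
pose cheap t := cheap_step x delta (A t) (C t.+1) (A t.+1) (C t.+2).
have cheapE t : cheap t =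
    (potential t - potential t.+1 < (delta / n%:R ^+ 2) ^+ 2) by [].
have split t : (t < 2 * m)%N -> cheap t ->
    exists s y, [/\ s != y, `|x s - x y| <= delta, A t s = A t y & A t.+1 s != A t.+1 y].
  move=> tm ch; apply: (cheap_step_split (ltW d0) ntc _ _ _ _ _ (chg t tm) ch).
  - exact: convex_assign.
  - exact: convex_assign.
  - exact: centered_update.
  - exact: centered_update.
  - by move=> i j; exact: assign_le.
have drop2 t : (t.+1 < 2 * m)%N ->
    (delta / n%:R ^+ 2) ^+ 2 <= potential t - potential t.+2.
  move=> tm.
  have le1 := ltW (potential_decr (chg t (ltnW tm))).
  have le2 := ltW (potential_decr (chg t.+1 tm)).
  have [ch1|] := boolP (cheap t); last first.
    rewrite cheapE -leNgt => h; apply: (le_trans h).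
    by rewrite lerD2l lerN2.
  have [ch2|] := boolP (cheap t.+1); last first.
    rewrite cheapE -leNgt => h; apply: (le_trans h).
    by rewrite lerD2r.
  have [s [y [sy d _ ne]]] := split _ (ltnW tm) ch1.
  have [s' [y' [sy' d' e' _]]] := split _ tm ch2.
  exfalso; move: ne; have [[-> ->]|[-> ->]] := close_pair_uniq ntc sy d sy' d'.
    by rewrite e' eqxx.
  by rewrite e' eqxx.
have ind i : (i <= m)%N ->
    i%:R * (delta / n%:R ^+ 2) ^+ 2 <= potential 0 - potential (2 * i)%N.
  elim: i => [|i IH] im; first by rewrite muln0 mul0r subrr.
  have := IH (ltnW im); have := @drop2 (2 * i)%N.
  rewrite (_ : 2 * i.+1 = (2 * i).+2)%N; last by lia.
  rewrite -natr1 mulrDl mul1r => /(_ ltac:(lia)).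
  move: (potential _) (potential _) (potential _) => p0 p1 p2; lra.
apply: (le_trans (ind m (leqnn m))).
by rewrite gerDl oppr_le0 potential_ge0.
Qed.
End Runs.

Local Open Scope classical_set_scope.
Local Open Scope ring_scope.

(** * Measurability *)

Section Measurability.
Variables (R : realType) (d : measure_display) (T : measurableType d).

Lemma measurable_boolT (b : T -> bool) :
  measurable_fun setT b -> measurable [set w | b w].
Proof.
by move=> mb; rewrite -[X in measurable X]setTI -preimage_true; exact: mb.
Qed.

Lemma measurable_constT (Q : Prop) : measurable [set _ : T | Q].
Proof.
have [q|q] := pselect Q; [rewrite (_ : mkset _ = setT)|rewrite (_ : mkset _ = set0)] => //.
  by apply/seteqP; split.
by apply/seteqP; split.
Qed.

Lemma measurable_ltT (f g : T -> R) : measurable_fun setT f ->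
  measurable_fun setT g -> measurable [set w | f w < g w].
Proof. by move=> mf mg; apply/measurable_boolT/measurable_fun_ltr. Qed.

Lemma measurable_leT (f g : T -> R) : measurable_fun setT f ->
  measurable_fun setT g -> measurable [set w | f w <= g w].
Proof. by move=> mf mg; apply/measurable_boolT/measurable_fun_ler. Qed.

Lemma measurable_forallT (I : finType) (Q : I -> T -> Prop) :
  (forall i, measurable [set w | Q i w]) -> measurable [set w | forall i, Q i w].
Proof.
move=> mQ; rewrite (_ : mkset _ = \bigcap_(i in setT) [set w | Q i w]).
  by apply: fin_bigcap_measurable.
by apply/seteqP; split=> w /= h i; [move=> _|]; exact: h.
Qed.

Lemma measurable_existsT (I : finType) (Q : I -> T -> Prop) :
  (forall i, measurable [set w | Q i w]) -> measurable [set w | exists i, Q i w].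
Proof.
move=> mQ; rewrite (_ : mkset _ = \bigcup_(i in setT) [set w | Q i w]).
  by apply: fin_bigcup_measurable.
by apply/seteqP; split=> w [i] => [h|_ h]; exists i.
Qed.

(** The preimage splits over the finitely many values of [F]. This handles the centers, which depend
    measurably on the points for each fixed clustering. *)
Lemma measurable_fun_finite_choice (I : finType) (F : T -> I) (G : I -> T -> R) :
  (forall i, measurable [set w | F w = i]) -> (forall i, measurable_fun setT (G i)) ->
  measurable_fun setT (fun w => G (F w) w).
Proof.
move=> mF mG _ B mB; rewrite setTI.
rewrite (_ : _ @^-1` _ = [set w | exists i, F w = i /\ B (G i w)]).
  apply: measurable_existsT => i; apply: measurableI => //.
    exact: mF.
  by have := mG i measurableT B mB; rewrite setTI.
by apply/seteqP; split=> w /= => [h|[i [<-]]//]; exists (F w).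
Qed.

Variables (n k : nat) (X : 'I_n -> T -> R) (c0 : 'I_k.+1 -> R).
Hypothesis mX : forall i, measurable_fun setT (X i).

Lemma measurable_assign (C : 'I_k.+1 -> T -> R) a :
  (forall j, measurable_fun setT (C j)) ->
  measurable [set w | kmeans_assign (X ^~ w) (C ^~ w) = a].
Proof.
move=> mC.
have md i j : measurable_fun setT (fun w => `|X i w - C j w|).
  by apply: measurableT_comp => //; exact: measurable_funB.
rewrite (_ : mkset _ = [set w | forall i m, `|X i w - C (a i) w| < `|X i w - C m w| \/
    (`|X i w - C (a i) w| <= `|X i w - C m w| /\ (a i <= m)%N)]).
  apply: measurable_forallT => i; apply: measurable_forallT => m.
  apply: measurableU; first exact: measurable_ltT.
  by apply: measurableI; [exact: measurable_leT|exact: measurable_constT].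
apply/seteqP; split=> w /= => [<- i m|h].
  have /forallP/(_ m)/orP[?|/andP[]] := nearest_assign (X ^~ w) (C ^~ w) i; first by left.
  by right.
apply/ffunP => i; apply/eqP; rewrite assignE; apply/forallP => m.
by apply/orP; have [|[? ?]] := h i m; [left|right; apply/andP].
Qed.

Let state t w := kmeans_state (X ^~ w) c0 t.

Lemma measurable_state t :
  (forall j, measurable_fun setT (fun w => (state t w).2 j)) /\
  (forall a, measurable [set w | kmeans_assign (X ^~ w) (state t w).2 = a]).
Proof.
suff H : forall j, measurable_fun setT (fun w => (state t w).2 j).
  by split=> // a; exact: (@measurable_assign (fun j w => (state t w).2 j)).
elim: t => [|t IH] j.
  by rewrite (_ : (fun w => _) = cst (c0 j))//; apply/funext => w; rewrite /= ffunE.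
pose F w := kmeans_assign (X ^~ w) (state t w).2.
apply: (@measurable_fun_finite_choice _ F
  (fun a w => kmeans_update (X ^~ w) a (state t w).2 j)) => a.
  exact: (@measurable_assign (fun j w => (state t w).2 j)).
rewrite (_ : (fun w => _) = (fun w => if #|[set i | a i == j]| == 0%N
    then (state t w).2 j
    else (\sum_(i <- [seq i <- index_enum 'I_n | a i == j]) X i w) /
      #|[set i | a i == j]|%:R)); last first.
  by apply/funext => w; rewrite ffunE big_filter.
case: (_ == 0%N); first exact: IH.
by apply: measurable_funM => //; exact: measurable_sum.
Qed.

Lemma measurable_state_eq t : measurable [set w | state t.+1 w = state t w].
Proof.
(* The initial state carries no clustering, so it never equals the next one. *)
case: t => [|t]; first by rewrite (_ : mkset _ = set0)//; apply/seteqP; split.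
pose F t w := kmeans_assign (X ^~ w) (state t w).2.
rewrite (_ : mkset _ = [set w | exists a, F t.+1 w = a /\ F t w = a] `&`
   [set w | forall j, (state t.+2 w).2 j = (state t.+1 w).2 j]).
  apply: measurableI.
    by apply: measurable_existsT => a; apply: measurableI;
      exact: (measurable_state _).2.
  apply: measurable_forallT => j.
  rewrite (_ : mkset _ = [set w | (state t.+2 w).2 j == (state t.+1 w).2 j]).
    by apply/measurable_boolT/measurable_fun_eqr; exact: (measurable_state _).1.
  by apply/seteqP; split=> w /= /eqP.
apply/seteqP; split=> w.
  move=> e; split; last by move=> j; rewrite e.
  by exists (F t w); split=> //; have := congr1 fst e => -[].
move=> [[a [e1 e2]] /ffunP e3].
have E u : state u.+1 w = (Some (F u w), (state u.+1 w).2) by [].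
by rewrite /mkset [LHS]E [RHS]E e1 e2 e3.
Qed.

Lemma measurable_iterations :
  measurable_fun setT (fun w => kmeans_iterations (X ^~ w) c0).
Proof.
(* The value [+oo] at indices without a stop turns the infimum into a countable one over all
   indices. *)
pose f t w : \bar R := if `[< state t.+1 w = state t w >] then t.+1%:R%:E else +oo%E.
rewrite (_ : (fun w => _) = (fun w => einfs (f ^~ w) 0)).
  apply: measurable_fun_einfs => t; apply: measurable_fun_ifT => //.
  apply: (measurable_fun_bool true); rewrite setTI preimage_true.
  rewrite (_ : mkset _ = [set w | state t.+1 w = state t w]).
    exact: measurable_state_eq.
  by apply/seteqP; split=> w /= /asboolP.
apply/funext => w; apply/eqP; rewrite eq_le; apply/andP; split.
  apply: le_ereal_inf_tmp => _ [t /= _ <-]; rewrite /f; case: asboolP => [e|_].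
    by apply: ereal_inf_lbound; exists t.+1.
  exact: leey.
apply: le_ereal_inf_tmp => _ [[|t] /= [// _ e] <-].
apply: ereal_inf_lbound; exists t => //.
by rewrite /f; case: asboolP.
Qed.
End Measurability.

(** * Perturbed points *)

Section NormalEstimates.
Variables (R : realType) (sigma : R).
Hypothesis sigma_gt0 : 0 < sigma.

Let sigma_neq0 : sigma != 0. Proof. exact: lt0r_neq0. Qed.

Lemma normal_peak_le : normal_peak sigma <= sigma^-1.
Proof.
rewrite /normal_peak lef_pV2 ?posrE ?sqrtr_gt0//; last first.
  by rewrite mulrn_wgt0// mulr_gt0 ?pi_gt0// exprn_gt0.
rewrite -[leLHS](ger0_norm (ltW sigma_gt0)) -sqrtr_sqr ler_sqrt; last first.
  by rewrite mulrn_wge0// mulr_ge0 ?sqr_ge0 ?pi_ge0.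
rewrite -mulrnAr ler_peMr ?sqr_ge0//.
by have := pi_ge2 R; rewrite mulr2n; lra.
Qed.

Lemma normal_prob_itv_le (a b : R) : a <= b ->
  (normal_prob 0 sigma `[a, b] <= ((b - a) / sigma)%:E)%E.
Proof.
move=> ab; rewrite /normal_prob.
apply: (@le_trans _ _ (\int[lebesgue_measure]_(x in `[a, b]) (cst sigma^-1%:E x))%E).
  apply: ge0_le_integral => //=.
  - by move=> x _; rewrite lee_fin normal_pdf_ge0.
  - by apply/measurable_EFinP/measurable_funTS; exact: measurable_normal_pdf.
  - move=> x _; rewrite lee_fin; apply: le_trans normal_peak_le.
    exact: normal_pdf_ub.
rewrite integral_cst//= lebesgue_measure_itv/= lte_fin.
case: ifP => _; first by rewrite -EFinB -EFinM lee_fin mulrC.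
by rewrite mule0 lee_fin divr_ge0// ?subr_ge0// ltW.
Qed.

(* The density is compared with that of twice the standard deviation, whose
   total mass is 1. *)
Lemma normal_prob_tail_le (u : R) : 0 <= u ->
  (normal_prob 0 sigma [set y | (u * sigma <= `|y|)%R] <=
     (2 * expR (- (3 / 8 * u ^+ 2)))%:E)%E.
Proof.
move=> u0; rewrite /normal_prob; set A := mkset _.
have mA : measurable A.
  by apply: measurable_leT => //; exact: measurable_normr.
have s20 : 2 * sigma != 0 by rewrite mulf_neq0.
pose K := 2 * expR (- (3 / 8 * u ^+ 2)).
have K0 : 0 <= K by rewrite mulr_ge0// expR_ge0.
have mpdf s (B : set R) : measurable_fun B (fun x => (normal_pdf 0 s x)%:E).
  by apply/measurable_EFinP/measurable_funTS; exact: measurable_normal_pdf.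
apply: (@le_trans _ _ (\int[lebesgue_measure]_(x in A)
    (K%:E * (normal_pdf 0 (2 * sigma) x)%:E))%E).
  apply: ge0_le_integral => //.
  - by move=> x _; rewrite lee_fin normal_pdf_ge0.
  - exact: mpdf.
  - by apply: measurable_funeM; exact: mpdf.
  (* The ratio of the two densities is [2 * expR (- (1/2 - 1/8) * x^2 / sigma^2)], the origin of [2]
     and [3 / 8]. *)
  move=> x Ax; rewrite -EFinM lee_fin !normal_pdfE// /K.
  have -> : normal_peak (2 * sigma) = normal_peak sigma / 2.
    rewrite /normal_peak -[X in _ = _ * X^-1](ger0_norm (ler0n R 2)) -sqrtr_sqr -invfM -sqrtrM.
      by congr (Num.sqrt _)^-1; ring.
    by rewrite mulrn_wge0// mulr_ge0 ?sqr_ge0 ?pi_ge0.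
  rewrite /normal_fun !subr0 [leRHS](_ : _ = normal_peak sigma *
    (expR (- (3 / 8 * u ^+ 2)) * expR (- x ^+ 2 / ((2 * sigma) ^+ 2 *+ 2)))); last by field.
  rewrite ler_wpM2l ?normal_peak_ge0// -expRD ler_expR.
  have : u ^+ 2 <= x ^+ 2 / sigma ^+ 2.
    rewrite ler_pdivlMr ?exprn_gt0// -exprMn -(real_normK (num_real x)).
    by rewrite ler_sqr ?nnegrE// mulr_ge0// ltW.
  have -> : - x ^+ 2 / (sigma ^+ 2 *+ 2) = - (x ^+ 2 / sigma ^+ 2) / 2.
    by field.
  have -> : - x ^+ 2 / ((2 * sigma) ^+ 2 *+ 2) = - (x ^+ 2 / sigma ^+ 2) / 8.
    by field.
  lra.
rewrite ge0_integralZl_EFin//; [|by move=> x _; rewrite lee_fin normal_pdf_ge0|exact: mpdf].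
rewrite -/K -[leRHS]mule1 lee_pmul//.
  by apply: integral_ge0 => x _; rewrite lee_fin normal_pdf_ge0.
rewrite -(integral_normal_pdf 0 (2 * sigma)).
apply: ge0_subset_integral => //; first exact: mpdf.
by move=> x _; rewrite lee_fin normal_pdf_ge0.
Qed.
End NormalEstimates.

(** * Finite unions of events *)

Section UnionBounds.
Variables (R : realType) (d : measure_display) (T : measurableType d).
Variable P : probability T R.

Lemma union_bound (I : finType) (E : set T) (F : I -> set T) : measurable E ->
  (forall i, measurable (F i)) -> (forall w, E w -> exists i, F i w) ->
  (P E <= \sum_i P (F i))%E.
Proof.
move=> mE mF EF.
have mU s : measurable (\big[setU/set0]_(i <- s) F i).
  by apply: bigsetU_measurable.
apply: (@le_trans _ _ (P (\big[setU/set0]_(i <- index_enum I) F i))).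
  apply: le_measure; rewrite ?inE// => w /EF[i Fi].
  by rewrite -bigcup_seq; exists i => //=; rewrite mem_index_enum.
elim: (index_enum I) => [|i s IH]; first by rewrite !big_nil measure0.
rewrite !big_cons; apply: (le_trans (measureU2 _ _ _)) => //.
exact: leeD.
Qed.

Lemma sum_disjoint_le N (E : set T) (F : 'I_N -> set T) : measurable E ->
  (forall i, measurable (F i)) -> trivIset setT F ->
  (\sum_i P (E `&` F i) <= P E)%E.
Proof.
move=> mE mF tF.
have mEF i : measurable (E `&` F i) by exact: measurableI.
rewrite -(@measure_bigsetU_ord _ _ _ P N xpredT (fun i => E `&` F i))//; last first.
  exact: trivIset_setIl.
apply: le_measure; rewrite ?inE//; first exact: bigsetU_measurable.
by rewrite -bigcup_seq => w [i _ []].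
Qed.
End UnionBounds.

(** * The number of iterations on perturbed points *)

Section SmoothedRuns.
Variables (R : realType) (d : measure_display) (T : measurableType d).
Variables (P : probability T R) (n k : nat) (sigma : R).
Variables (mu : 'I_n -> R) (g : 'I_n -> T -> R) (c0 : 'I_k.+1 -> R).
Hypothesis sigma_gt0 : 0 < sigma.
Hypothesis mu01 : forall i, 0 <= mu i <= 1.
Hypothesis kn : (k.+1 <= n)%N.
Hypothesis gP : indep_gaussians P sigma g.

Let mg i : measurable_fun setT (g i). Proof. by case: gP. Qed.

Let X i w := mu i + g i w.

Let mX i : measurable_fun setT (X i).
Proof. by apply: measurable_funD => //; exact: mg. Qed.

Let measurable_gI i (B : set R) : measurable B -> measurable (g i @^-1` B).
Proof. by move=> mB; have := mg i measurableT mB; rewrite setTI. Qed.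

(** The bound [M] confines the reference points to a finite grid. *)
Let close u r u' r' (delta M : R) := [set w |
  [/\ `|X u w - X r w| <= delta, `|X u' w - X r' w| <= delta &
      forall i, `|X i w| <= M]].

Let measurable_close u r u' r' delta M : measurable (close u r u' r' delta M).
Proof.
have mN i j : measurable_fun setT (fun w : T => `|X i w - X j w|).
  by apply: measurableT_comp => //; exact: measurable_funB.
rewrite (_ : close _ _ _ _ _ _ = [set w | `|X u w - X r w| <= delta] `&`
   ([set w | `|X u' w - X r' w| <= delta] `&` [set w | forall i, `|X i w| <= M])).
  apply: measurableI; first exact: measurable_leT.
  apply: measurableI; first exact: measurable_leT.
  by apply: measurable_forallT => i; apply: measurable_leT => //; exact: measurableT_comp.
by apply/seteqP; split=> w [h1]; [move=> h2 h3; split|move=> [h2 h3]; split].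
Qed.

Let bigcap_pin (B : 'I_n -> set R) u J : B u = setT ->
  \bigcap_(i in setT) (g i @^-1` (if i == u then J else B i)) =
  g u @^-1` J `&` \bigcap_(i in setT) (g i @^-1` B i).
Proof.
move=> Bu; apply/seteqP; split=> w /=.
  move=> h; split; first by have := h u I; rewrite /= eqxx.
  move=> i _ /=; have := h i I; rewrite /=.
  by case: eqVneq => // -> _; rewrite Bu.
by move=> [hu h] i _ /=; case: eqVneq => [->|_]//; exact: h.
Qed.

(** Independence is given for boxes that constrain every coordinate. As [B] leaves [u] free,
    inserting [J] there gives another box with the same remaining factors. *)
Lemma indep_pin (B : 'I_n -> set R) u J : (forall i, measurable (B i)) ->
  measurable J -> B u = setT ->
  (P (g u @^-1` J `&` \bigcap_(i in setT) (g i @^-1` B i)) =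
   P (g u @^-1` J) * P (\bigcap_(i in setT) (g i @^-1` B i)))%E.
Proof.
move=> mB mJ Bu; have [_ _ ind] := gP.
rewrite -bigcap_pin// ind; last by move=> i; case: ifP.
rewrite ind// (bigD1 u)//= [in RHS](bigD1 u)//= eqxx Bu preimage_setT probability_setT mul1e.
by congr (_ * _)%E; apply: eq_bigr => i /negbTE ->.
Qed.

Lemma indep_pin2 u r u' r' (J J' A A' : set R) :
  [/\ u != u', u != r, u != r', u' != r & u' != r'] ->
  measurable J -> measurable J' -> measurable A -> measurable A' ->
  (P (g u @^-1` J `&` (g u' @^-1` J' `&` (g r @^-1` A `&` g r' @^-1` A'))) =
   P (g u @^-1` J) * (P (g u' @^-1` J') * P (g r @^-1` A `&` g r' @^-1` A')))%E.
Proof.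
move=> [uu' ur ur' u'r u'r'] mJ mJ' mA mA'.
(* As [r] and [r'] may be equal, their constraints are intersected and their joint probability is
   kept as one factor. *)
pose B0 i := (if i == r then A else setT) `&` (if i == r' then A' else setT).
have mB0 i : measurable (B0 i) by apply: measurableI; case: ifP.
have B0u : B0 u = setT by rewrite /B0 (negbTE ur) (negbTE ur') setIT.
have B0u' : B0 u' = setT by rewrite /B0 (negbTE u'r) (negbTE u'r') setIT.
have -> : g r @^-1` A `&` g r' @^-1` A' = \bigcap_(i in setT) (g i @^-1` B0 i).
  apply/seteqP; split=> w /=.
    by move=> [hA hA'] i _; split; case: eqVneq => // ->.
  move=> h; have [] := h r I; have [] := h r' I; rewrite /= !eqxx.
  by move=> _ ? ? _; split.
rewrite -(indep_pin mB0 mJ' B0u') -(bigcap_pin _ B0u').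
rewrite indep_pin//; last by rewrite (negbTE uu').
by move=> i; case: ifP.
Qed.

(* Conditioning on the cells of a grid of mesh [delta] that contain the two
   reference points confines each of the other two points to an interval of
   length [3 * delta]. *)
Lemma prob_two_close u r u' r' (delta M : R) : 0 < delta -> 0 <= M ->
  [/\ u != u', u != r, u != r', u' != r & u' != r'] ->
  (P (close u r u' r' delta M) <= ((3 * delta / sigma) ^+ 2)%:E)%E.
Proof.
move=> d0 M0 neq; set E := close _ _ _ _ _ _.
pose N := (Num.truncn (2 * M / delta)).+1.
pose A i (m : 'I_N) := [set y |
    - M + m%:R * delta <= mu i + y /\ mu i + y < - M + m.+1%:R * delta].
pose J i (m : 'I_N) := `[
    - M + (m%:R - 1) * delta - mu i, - M + (m%:R + 2) * delta - mu i]%classic.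
have mA i m : measurable (A i m).
  apply: measurableI; first by apply: measurable_leT => //; exact: measurable_funD.
  by apply: measurable_ltT => //; exact: measurable_funD.
have mJ i m : measurable (J i m) by exact: measurable_itv.
have mE : measurable E by exact: measurable_close.
pose Fe i m := g i @^-1` A i m.
have mF i m : measurable (Fe i m) by exact: measurable_gI.
have grid i w : `|X i w| <= M -> exists m : 'I_N, Fe i m w.
  rewrite ler_norml => /andP[l1 l2].
  have y0 : 0 <= (X i w + M) / delta by rewrite divr_ge0 ?(ltW d0)//; lra.
  have mlt : (Num.truncn ((X i w + M) / delta) < N)%N.
    by rewrite ltnS; apply: le_truncn; rewrite ler_pM2r ?invr_gt0//; lra.
  exists (Ordinal mlt); rewrite /Fe /A /=.
  have /andP[h1 h2] := truncn_itv y0.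
  move: h1 h2; rewrite ler_pdivlMr// ltr_pdivrMr// => h1 h2.
  by rewrite -/(X i w); split; lra.
have confine i j m w : Fe j m w -> `|X i w - X j w| <= delta -> (g i @^-1` J i m) w.
  move=> [h1 h2]; rewrite ler_norml => /andP[h3 h4].
  rewrite /J /= in_itv /=; move: h1 h2 h3 h4; rewrite /X -natr1 => *.
  by apply/andP; split; lra.
pose G (p : 'I_N * 'I_N) := g u @^-1` J u p.1 `&` (g u' @^-1` J u' p.2 `&`
   (Fe r p.1 `&` Fe r' p.2)).
have mG p : measurable (G p).
  by do 3 (apply: measurableI; first by exact: measurable_gI); exact: mF.
apply: (le_trans (@union_bound _ _ _ P _ E G mE mG _)).
  move=> w [cl cl' bd]; have [m rm] := grid r w (bd r).
  have [m' rm'] := grid r' w (bd r'); exists (m, m').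
  by split; [exact: (confine _ _ _ _ rm cl)|split; [exact: (confine _ _ _ _ rm' cl')|split]].
pose K := 3 * delta / sigma.
have K0 : 0 <= K by rewrite divr_ge0 ?mulr_ge0// ltW.
have PJ i m : (P (g i @^-1` J i m) <= K%:E)%E.
  have [_ nrm _] := gP; rewrite nrm//.
  apply: le_trans (normal_prob_itv_le sigma_gt0 _) _.
    by rewrite lerD2r lerD2l ler_pM2r//; lra.
  by rewrite lee_fin ler_pM2r ?invr_gt0//; lra.
have PG p : (P (G p) <= K%:E * K%:E * P (Fe r p.1 `&` Fe r' p.2))%E.
  rewrite indep_pin2// -muleA lee_pmul// ?mule_ge0//.
  by rewrite lee_pmul.
apply: (le_trans (lee_sum _ (fun p _ => PG p))).
(* The factor [K * K] is common to all grid cells; the remaining probabilities belong to disjoint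
   events and sum to at most 1. *)
rewrite -ge0_sume_distrr//.
rewrite expr2 EFinM -[leRHS]mule1 lee_pmul//.
  by rewrite mule_ge0// lee_fin.
  by apply: sume_ge0.
have tF i : trivIset setT (Fe i).
  apply/trivIsetP => m m' _ _ mm'; apply/seteqP; split=> // w [[h1 h2] [h3 h4]].
  move/eqP: mm'; apply; apply/val_inj/anti_leq; rewrite -ltnS -[X in _ && X]ltnS.
  rewrite -!(ltr_nat R).
  by apply/andP; split; rewrite -(ltr_pM2r d0); lra.
rewrite -(pair_bigA _ (fun m m' => P (Fe r m `&` Fe r' m'))) /=.
apply: (@le_trans _ _ (\sum_m P (setT `&` Fe r m))%E).
  by apply: lee_sum => m _; rewrite setTI; exact: sum_disjoint_le.
rewrite -(probability_setT P); exact: sum_disjoint_le.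
Qed.

Let iter w := kmeans_iterations (X ^~ w) c0.

Let eq_ler (x y : R) : x = y -> x <= y. Proof. by move=> ->. Qed.

Let n_gt0 : 0 < n%:R :> R.
Proof. by rewrite ltr0n; exact: leq_ltn_trans kn. Qed.

Lemma measurable_smoothed_iterations : measurable_fun setT iter.
Proof.
exact: (@measurable_iterations _ _ _ _ _ X).
Qed.

Lemma measurable_iterations_gt (x : \bar R) : measurable [set w | (x < iter w)%E].
Proof.
have := measurable_smoothed_iterations measurableT (emeasurable_itv `]x, +oo[).
rewrite setTI; congr measurable; apply/seteqP; split=> w /=; rewrite in_itv/= ?andbT//.
Qed.

Lemma prob_iterations_gt m : (0 < m)%N ->
  (P [set w | (2 * m + 2)%:R%:E < iter w] <=
    (18 * n%:R ^+ 9 * (sigma^-1 + 2 * n%:R) ^+ 2 / m%:R +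
     2 * n%:R * expR (- (3 / 8 * (2 * n%:R) ^+ 2)))%:E)%E.
Proof.
move=> m0.
have mR : 0 < m%:R :> R by rewrite ltr0n.
(* Cutting the noise at [2 * n * sigma] leaves a tail small enough to outweigh the worst case
   [2 ^ (n * n)]. *)
pose M : R := 1 + 2 * n%:R * sigma.
have M0 : 0 < M by rewrite ltr_pwDl// mulr_ge0 ?mulr_ge0// ltW.
(* With this choice [m] large drops add up to [2 * n * M ^+ 2], twice the bound on the initial
   potential. *)
pose delta := Num.sqrt (2 * n%:R ^+ 5 * M ^+ 2 / m%:R).
have d20 : 0 < 2 * n%:R ^+ 5 * M ^+ 2 / m%:R.
  by rewrite divr_gt0// !mulr_gt0// exprn_gt0.
have d0 : 0 < delta by rewrite sqrtr_gt0.
have d2 : delta ^+ 2 = 2 * n%:R ^+ 5 * M ^+ 2 / m%:R by rewrite sqr_sqrtr// ltW.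
pose dist (q : 'I_n * 'I_n * 'I_n * 'I_n) := let: (u, r, u', r') := q in
  [&& u != u', u != r, u != r', u' != r & u' != r'].
pose F (q : 'I_n * 'I_n * 'I_n * 'I_n + 'I_n) := match q with
  | inl q => if dist q then let: (u, r, u', r') := q in
      close u r u' r' delta M else set0
  | inr i => g i @^-1` [set y | 2 * n%:R * sigma <= `|y|]
  end.
have mA : measurable [set y : R | 2 * n%:R * sigma <= `|y|].
  by apply: measurable_leT => //; exact: measurable_normr.
have mF q : measurable (F q).
  case: q => [[[[u r] u'] r']|i] /=; last first.
    exact: measurable_gI.
  by case: ifP => // _; exact: measurable_close.
apply: (le_trans (@union_bound _ _ _ P _ _ F (measurable_iterations_gt _) mF _)).
  move=> w /= itw.
  have [[i hi]|small] := pselect (exists i, 2 * n%:R * sigma <= `|g i w|).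
    by exists (inr i).
  have bd i : `|X i w| <= M.
    have gi : `|g i w| < 2 * n%:R * sigma.
      by rewrite ltNge; apply/negP => h; apply: small; exists i.
    apply: (le_trans (ler_normD _ _)); apply: lerD; last exact: ltW.
    by have /andP[m1 m2] := mu01 i; rewrite ger0_norm.
  have [tc|ntc] := pselect (two_close_pairs (X ^~ w) delta).
    have [u [r [u' [r' [[h1 h2 h3 h4 h5] [cl cl']]]]]] := tc.
    by exists (inl (u, r, u', r')); rewrite /= h1 h2 h3 h4 h5.
  exfalso; have := run_potential d0 ntc itw.
  apply/negP; rewrite -ltNge; apply: (@le_lt_trans _ _ (n%:R * M ^+ 2)).
    apply: (@le_trans _ _ (\sum_(i < n) M ^+ 2)).
      apply: ler_sum => i _; rewrite -(real_normK (num_real (X i w))).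
      by rewrite ler_pXn2r ?nnegrE// ltW.
    by rewrite sumr_const card_ord -[leLHS]mulr_natl.
  rewrite expr_div_n d2.
  have -> : m%:R * (2 * n%:R ^+ 5 * M ^+ 2 / m%:R / (n%:R ^+ 2) ^+ 2) =
      2 * (n%:R * M ^+ 2).
    by field; rewrite !lt0r_neq0.
  by rewrite ltr_pMl ?ltr1n// mulr_gt0// exprn_gt0.
(* The [n ^ 4] quadruples and the fifth power in [delta ^+ 2] make the ninth power; [M / sigma] is
   [sigma^-1 + 2 * n]. *)
rewrite big_sumType /= EFinD; apply: leeD.
  apply: (@le_trans _ _ (\sum_(q : 'I_n * 'I_n * 'I_n * 'I_n)
      ((3 * delta / sigma) ^+ 2)%:E)%E).
    apply: lee_sum => -[[[u r] u'] r'] _ /=; case: ifP => [/and5P h|_].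
      exact: prob_two_close d0 (ltW M0) h.
    by rewrite measure0 lee_fin sqr_ge0.
  rewrite sumEFin lee_fin sumr_const !card_prod !card_ord -[leLHS]mulr_natl !natrM.
  rewrite expr_div_n exprMn d2 /M; apply: eq_ler; field.
  by rewrite !lt0r_neq0.
apply: (@le_trans _ _ (\sum_(i < n) (2 * expR (- (3 / 8 * (2 * n%:R) ^+ 2)))%:E)%E).
  apply: lee_sum => i _; have [_ nrm _] := gP; rewrite nrm//.
  by apply: normal_prob_tail_le => //; rewrite mulr_ge0// ltW.
rewrite sumEFin lee_fin sumr_const card_ord -[leLHS]mulr_natl; apply: eq_ler; ring.
Qed.

(** If [iter w] lies between the thresholds [2 * 2 ^ s + 2] and [2 * 2 ^ s.+1 + 2], then [4] plus
    the term of index [s] already exceeds the upper one. *)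
Lemma iterations_dyadic w :
  (iter w <= 4%:E + \sum_(s < n * n) (4 * 2 ^+ s)%:E *
     (\1_[set w | ((2 * 2 ^ s + 2)%:R%:E < iter w)%E] w)%:E)%E.
Proof.
have nn0 L : (0 <= \sum_(s < L) (4 * 2 ^+ s)%:E *
     (\1_[set w | ((2 * 2 ^ s + 2)%:R%:E < iter w)%E] w)%:E :> \bar R)%E.
  by apply: sume_ge0 => s _; rewrite mule_ge0// lee_fin ?mulr_ge0 ?exprn_ge0.
have ind L : (iter w <= (2 * 2 ^ L + 2)%:R%:E)%E ->
    (iter w <= 4%:E + \sum_(s < L) (4 * 2 ^+ s)%:E *
     (\1_[set w | ((2 * 2 ^ s + 2)%:R%:E < iter w)%E] w)%:E)%E.
  elim: L => [|L IH] hL; first by rewrite big_ord0 adde0.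
  rewrite big_ord_recr /=.
  have [h|h] := leP (iter w) (2 * 2 ^ L + 2)%:R%:E.
    by apply: (le_trans (IH h)); rewrite leeD2l// leeDl//.
  rewrite indicE mem_set// mule1; apply: (le_trans hL).
  rewrite addeCA -[leLHS]add0e; apply: leeD; first exact: nn0.
  rewrite -EFinD lee_fin natrD natrM natrX exprS; lra.
(* Since [k.+1 <= n <= 2 ^ n], the worst case is at most [2 ^ (n * n)], so no run passes the
   threshold of index [n * n]. *)
apply: ind; rewrite leNgt; apply/negP.
rewrite addn2 => /run_worst_case; apply/negP; rewrite -leqNgt.
apply: (@leq_trans (2 ^ (n * n))); last by rewrite leq_pmull.
rewrite expnM leq_exp2r//; last exact: leq_ltn_trans kn.
by apply: leq_trans kn _; rewrite ltnW// ltn_expl.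
Qed.

Lemma expected_iterations_le :
  (\int[P]_w iter w <= (588 * n%:R ^+ 13 * (1 + sigma^-1 ^+ 2))%:E)%E.
Proof.
pose E s := [set w | ((2 * 2 ^ s + 2)%:R%:E < iter w)%E].
have mE s : measurable (E s) by exact: measurable_iterations_gt.
have iter0 w : (0 <= iter w)%E.
  by apply: le_ereal_inf_tmp => _ [t _ <-]; rewrite lee_fin.
have m1 s : measurable_fun setT (fun w => (\1_(E s) w)%:E : \bar R).
  by apply/measurable_EFinP; exact: measurable_indic.
have mf s : measurable_fun setT
    (fun w => ((4 * 2 ^+ s)%:E * (\1_(E s) w)%:E)%E : \bar R).
  exact: measurable_funeM.
have c0' s : (0 <= (4 * 2 ^+ s)%:E :> \bar R)%E by rewrite lee_fin mulr_ge0// exprn_ge0.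
have f0 s w : (0 <= (4 * 2 ^+ s)%:E * (\1_(E s) w)%:E :> \bar R)%E.
  by rewrite mule_ge0// lee_fin.
have msum : measurable_fun setT (fun w =>
    \sum_(s < n * n) (4 * 2 ^+ s)%:E * (\1_(E s) w)%:E : \bar R)%E.
  by apply: emeasurable_sum => s; exact: mf.
apply: (@le_trans _ _ (\int[P]_w (4%:E +
    \sum_(s < n * n) (4 * 2 ^+ s)%:E * (\1_(E s) w)%:E))%E).
  apply: ge0_le_integral => //.
  - exact: measurable_smoothed_iterations.
  - by apply: emeasurable_funD => //; exact: msum.
  - by move=> w _; exact: iterations_dyadic.
rewrite ge0_integralD//; last by move=> w _; apply: sume_ge0.
rewrite integral_cst// [X in (4%:E * X)%E](_ : _ = 1%E); last exact: probability_setT.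
rewrite mule1 ge0_integral_sum//.
pose V := sigma^-1 + 2 * n%:R.
(* Multiplication by [4 * 2 ^+ s] makes the main part of the tail independent of [s] and the
   Gaussian part geometric in [s]. *)
apply: (@le_trans _ _ (4%:E + \sum_(s < n * n) (72 * n%:R ^+ 9 * V ^+ 2 +
    8 * n%:R * 2 ^+ s * expR (- (3 / 8 * (2 * n%:R) ^+ 2)))%:E)%E).
  rewrite leeD2l//; apply: lee_sum => s _.
  rewrite ge0_integralZl_EFin//.
  rewrite integral_indic// setIT.
  have h := @prob_iterations_gt (2 ^ s) (expn_gt0 2 s).
  apply: (le_trans (lee_wpmul2l _ h)) => //.
  rewrite -EFinM lee_fin natrX; apply: eq_ler; rewrite -/V; field.
  by rewrite expf_neq0.
rewrite sumEFin -EFinD lee_fin big_split /= sumr_const card_ord -mulr_suml -mulr_sumr.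
have geo : \sum_(s < n * n) 2 ^+ s <= 2 ^+ (n * n) :> R.
  have -> : \sum_(s < n * n) 2 ^+ s = 2 ^+ (n * n) - 1 :> R.
    by rewrite subrX1 addrK mul1r.
  by rewrite gerDl oppr_le0.
(* The Gaussian exponent is [- 3/2 * n^2], while [2 ^+ (n * n)] is at most [expR (n * n)]. *)
have e1 : 2 ^+ (n * n) * expR (- (3 / 8 * (2 * n%:R) ^+ 2)) <= 1 :> R.
  have e2 : 2 ^+ (n * n) <= expR ((n * n)%:R) :> R.
    rewrite -[(n * n)%:R]mulr1 expRM_natl lerXn2r ?nnegrE ?expR_ge0//.
    by have := expR_ge1Dx (1 : R); lra.
  apply: (le_trans (ler_wpM2r (expR_ge0 _) e2)).
  rewrite -expRD -[leRHS]expR0 ler_expR natrM.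
  have : 0 <= (n%:R * n%:R : R) by rewrite mulr_ge0.
  lra.
have N1 : 1 <= n%:R :> R by rewrite ler1n -(ltr0n R).
have pw a b : (a <= b)%N -> n%:R ^+ a <= n%:R ^+ b :> R by move=> ab; exact: ler_weXn2l.
have tl : 8 * n%:R * (\sum_(s < n * n) 2 ^+ s) *
    expR (- (3 / 8 * (2 * n%:R) ^+ 2)) <= 8 * n%:R :> R.
  rewrite -mulrA -[leRHS]mulr1 ler_pM2l ?mulr_gt0//.
  apply: le_trans e1; apply: ler_wpM2r geo; exact: expR_ge0.
set v := sigma^-1 in V *.
have V2 : V ^+ 2 <= 2 * v ^+ 2 + 8 * n%:R ^+ 2.
  by have := sqr_ge0 (v - 2 * n%:R); rewrite /V; lra.
have h1 : (72 * n%:R ^+ 9 * V ^+ 2) *+ (n * n) <=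
    144 * n%:R ^+ 11 * v ^+ 2 + 576 * n%:R ^+ 13 :> R.
  rewrite -mulr_natl natrM.
  have h : 72 * n%:R ^+ 11 * V ^+ 2 <= 72 * n%:R ^+ 11 * (2 * v ^+ 2 + 8 * n%:R ^+ 2).
    by rewrite ler_wpM2l// mulr_ge0// exprn_ge0.
  lra.
(* With all powers of [n] raised to the thirteenth, the constants add up to [588 = 4 + 8 + 576],
   which also covers the coefficient [144] of [v ^+ 2]. *)
have := pw 0 13 isT; have := pw 1 13 isT.
have := ler_wpM2r (sqr_ge0 v) (pw 11 13 isT).
have : 0 <= n%:R ^+ 13 * v ^+ 2 by rewrite mulr_ge0 ?sqr_ge0// exprn_ge0.
rewrite expr0 expr1; lra.
Qed.

(** Markov's inequality at [n] times the bound on the expectation, which raises the power of [n]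
    from 13 to 14. *)
Lemma prob_iterations_markov :
  (P [set w | (588 * n%:R ^+ 14 * (1 + sigma^-1 ^+ 2))%:E < iter w] <= (n%:R^-1)%:E)%E.
Proof.
pose p := 588 * n%:R ^+ 13 * (1 + sigma^-1 ^+ 2).
have p0 : 0 < p.
  apply: mulr_gt0; last by rewrite ltr_pwDl// sqr_ge0.
  by apply: mulr_gt0; [rewrite ltr0n|exact: exprn_gt0].
have -> : 588 * n%:R ^+ 14 * (1 + sigma^-1 ^+ 2) = n%:R * p by rewrite /p; ring.
set E := mkset _; have mE : measurable E by exact: measurable_iterations_gt.
have h : ((n%:R * p)%:E * P E <= p%:E)%E.
  apply: le_trans expected_iterations_le.
  rewrite -[E]setIT -(integral_indic P measurableT mE) -ge0_integralZl_EFin//; first last.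
  - by rewrite mulr_ge0// ltW.
  - by apply/measurable_EFinP; exact: measurable_indic.
  apply: ge0_le_integral => //.
  - by move=> w _; rewrite mule_ge0// lee_fin// mulr_ge0// ltW.
  - by apply: measurable_funeM; apply/measurable_EFinP; exact: measurable_indic.
  - exact: measurable_smoothed_iterations.
  move=> w _; rewrite indicE; have [/set_mem/ltW|_] := boolP (w \in E).
    by rewrite mule1.
  by rewrite mule0; apply: le_ereal_inf_tmp => _ [t _ <-]; rewrite lee_fin.
have fin : P E \is a fin_num by exact: fin_num_measure.
rewrite -(fineK fin) in h *; move: h; rewrite -EFinM !lee_fin.
rewrite -mulrA mulrCA -[leRHS]mulr1 ler_pM2l// => h.
by rewrite -[leRHS]mulr1 ler_pdivlMl.
Qed.
End SmoothedRuns.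

(** Two nonzero coefficients express both bounds; the degree [N.+2] keeps the exponent 2 of [v] in
    range. *)
Lemma bipoly_monomials (R : realType) N (K u v : R) :
  bipoly N.+2 (fun i j => if (i == N.+2) && ((j == 0) || (j == 2))%N then K else 0) u v
  = K * u ^+ N.+2 * (1 + v ^+ 2).
Proof.
rewrite /bipoly (bigD1 ord_max)//= [X in _ + X]big1 ?addr0; last first.
  move=> i; rewrite -val_eqE /= => /negbTE iN; apply: big1 => j _.
  by rewrite iN /= !mul0r.
rewrite eqxx /=; do 3 rewrite big_ord_recl /=.
rewrite big1 ?addr0; last by move=> j _; rewrite !mul0r.
by rewrite !mul0r add0r expr0; ring.
Qed.

Unset Implicit Arguments.

Theorem theorem4 (R : realType) :
  (exists (D : nat) (p : nat -> nat -> R),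
    forall (n k : nat) (sigma : R) (mu : 'I_n -> R)
           (d : measure_display) (T : measurableType d) (P : probability T R)
           (g : 'I_n -> T -> R) (c0 : 'I_k.+1 -> R),
      (k.+1 <= n)%N -> 0 < sigma -> (forall i, 0 <= mu i <= 1) ->
      indep_gaussians P sigma g ->
      measurable_fun [set: T]
        (fun w => kmeans_iterations (fun i => (mu i + g i w)%R) c0) /\
      (\int[P]_w kmeans_iterations (fun i => (mu i + g i w)%R) c0
         <= (bipoly D p n%:R sigma^-1)%R%:E)%E)
  /\
  (exists (D : nat) (q : nat -> nat -> R) (e : R), 0 < e /\
    forall (n k : nat) (sigma : R) (mu : 'I_n -> R)
           (d : measure_display) (T : measurableType d) (P : probability T R)
           (g : 'I_n -> T -> R) (c0 : 'I_k.+1 -> R),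
      (k.+1 <= n)%N -> 0 < sigma -> (forall i, 0 <= mu i <= 1) ->
      indep_gaussians P sigma g ->
      let E := [set w | ((bipoly D q n%:R sigma^-1)%R%:E
                          < kmeans_iterations (fun i => (mu i + g i w)%R) c0)%E] in
      measurable E /\ (P E <= (n%:R `^ (- e))%R%:E)%E).
Proof.
split.
  exists 13%N, (fun i j => if (i == 13) && ((j == 0) || (j == 2))%N then 588 else 0).
  move=> n k sigma mu d T P g c0 kn s0 mu01 gP.
  rewrite bipoly_monomials; split; first exact: (measurable_smoothed_iterations _ _ gP).
  exact: expected_iterations_le.
exists 14%N, (fun i j => if (i == 14) && ((j == 0) || (j == 2))%N then 588 else 0), 1.
split=> // n k sigma mu d T P g c0 kn s0 mu01 gP E; rewrite /E bipoly_monomials.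
split; first exact: (measurable_iterations_gt _ _ gP).
by rewrite powR_inv1//; exact: prob_iterations_markov.
Qed.
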